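(* For every integer $n\ge 1$, the $n$-dimensional Menger space $\mu^n$ satisfies $\operatorname{cat}_g \mu^n=1$.
   Context: A subset $A\subset X$ is contractible in $X$ if the inclusion map $A\to X$ is homotopic to a constant map. The general LS-category $\operatorname{cat}_g X$ is the smallest integer $k$ such that $X=\bigcup_{i=0}^{k}A_i$, where each $A_i$ is an arbitrary subset of $X$ contractible in $X$ (infinite if no such $k$ exists). The $n$-dimensional Menger space is $\mu^n=\bigcap_{j\ge 0}\bigcup\mathcal M_j\subset [0,1]^{2n+1}$, where $\mathcal M_0=\{[0,1]^{2n+1}\}$ and $\mathcal M_{j+1}$ is obtained by subdividing each cube $Q\in\mathcal M_j$ into $3^{2n+1}$ congruent subcubes and keeping those that meet the $n$-skeleton (the union of the $n$-dimensional faces) of $Q$. *)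

(* Defs.v *)
From HB Require Import structures.
From mathcomp Require Import all_boot all_order all_algebra.
From mathcomp Require Import all_classical all_reals all_analysis.

Set Implicit Arguments.
Unset Strict Implicit.
Unset Printing Implicit Defensive.

Import Order.TTheory GRing.Theory Num.Theory.
Import numFieldNormedType.Exports.

Local Open Scope classical_set_scope.
Local Open Scope ring_scope.

Section homotopy.
Variables (R : realType) (A X : topologicalType).

(* Only the restriction of H to A x [0, 1] matters: the values of H at times
   outside [0, 1] are unconstrained. *)
Definition homotopic (f g : A -> X) : Prop :=
  exists H : A * R -> X,
    [/\ {within [set: A] `*` `[0, 1], continuous H},
        forall a, H (a, 0) = f a
      & forall a, H (a, 1) = g a].

End homotopy.

Section general_category.
Variables (R : realType) (X : topologicalType).

(* [set_val] is the inclusion into X of A, seen as a space for the subspace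
   topology. *)
Definition contractible_in (A : set X) : Prop :=
  exists c : X, homotopic R (set_val : A -> X) (cst c).

Definition categorical_cover (k : nat) : Prop :=
  exists A : 'I_k.+1 -> set X,
    \bigcup_i A i = [set: X] /\ forall i, contractible_in (A i).

Definition catg : \bar nat :=
  if pselect (exists k, `[< categorical_cover k >]) is left ex_cover
  then (ex_minn ex_cover)%:E else +oo%E.

End general_category.

Section cubes.
Variables (R : realType) (m : nat).
Implicit Types (a x : 'rV[R]_m) (s : R).

(* The cube with least corner a and side s. *)
Definition cube a s : set 'rV[R]_m :=
  [set x | forall i, a 0 i <= x 0 i <= a 0 i + s].

(* The coordinates in F are free; each other coordinate is constant, at its
   upper value if it is in E and at its lower value otherwise. *)
Definition face a s (F E : {set 'I_m}) : set 'rV[R]_m :=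
  [set x | cube a s x /\
    forall i, i \notin F -> x 0 i = if i \in E then a 0 i + s else a 0 i].

Definition skeleton (d : nat) a s : set 'rV[R]_m :=
  \bigcup_(F in [set F : {set 'I_m} | #|F| = d]) \bigcup_E face a s F E.

(* Least corner of the subcube with index k among the 3 ^ m congruent
   subcubes, of side s / 3, of [cube a s]. *)
Definition subcorner a s (k : {ffun 'I_m -> 'I_3}) : 'rV[R]_m :=
  \row_i (a 0 i + (k i)%:R * (s / 3)).

(* Least corners of the cubes of the j-th stage; these have side 3 ^- j. *)
Fixpoint stage_corners (d j : nat) : set 'rV[R]_m :=
  if j is j'.+1 then
    [set b | exists a k,
      [/\ stage_corners d j' a, b = subcorner a (3 ^- j') k
        & cube b (3 ^- j) `&` skeleton d a (3 ^- j') !=set0]]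
  else [set 0].

End cubes.

Definition menger_set (R : realType) (n : nat) : set 'rV[R]_(n.*2.+1) :=
  \bigcap_j \bigcup_(a in stage_corners n j) cube a (3 ^- j).
Arguments menger_set : clear implicits.

(* Subspace topology, from the product topology on row vectors. *)
Definition menger_space (R : realType) (n : nat) : topologicalType := menger_set R n.

(* Main.v *)
Require Import Defs.
From mathcomp Require Import all_boot all_order all_algebra.
From mathcomp Require Import all_classical all_reals all_analysis.
From mathcomp Require Import ring lra zify.

(** Write x in ternary. A point of the cube lies in mu^n iff at every level at
    most n coordinates lie in the interior of a middle third.

    Upper bound. Let q be 1/2 or 3/8, and let A_q be the set of points of mu^n
    with fewer than n coordinates in the grid of all (k + q) / 3^l. The ternary
    expansion of 1/2 is 0.111..., that of 3/8 is 0.1010..., so A_{1/2} and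
    A_{3/8} cover mu^n. On A_q, stretching small windows around the q-points of
    the grid of mesh 3^-j maps A_q continuously to points with fewer than n
    coordinates off 3^-j Z. Hence the j-th approximation can be deformed into
    the next one by moving one coordinate at a time without leaving mu^n, and
    the concatenation of these deformations converges to the identity.

    Lower bound. The boundary of an (n+1)-face of the big cube lies in mu^n,
    while the projection of mu^n to that face misses its centre. A contraction
    of mu^n would thus contradict the Poincare-Miranda theorem. The latter
    follows from a mod 2 count on a grid: if f_i is 0 on the lower and 1 on the
    upper i-th faces, Stokes' theorem for the cubical cup product shows by
    induction that df_1 \cup ... \cup df_N does not vanish, and a cube where it
    does not vanish sees both values of every f_i. *)

Set Implicit Arguments.
Unset Strict Implicit.
Unset Printing Implicit Defensive.
Import Order.TTheory GRing.Theory Num.Theory.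
Import numFieldNormedType.Exports.
Local Open Scope classical_set_scope.
Local Open Scope ring_scope.

(** * Cubical cochains mod 2 and the Poincare-Miranda theorem *)

Section cubical_cup_product.
Variables (I : finType) (V : zmodType) (e : I -> V).
Implicit Types (f : V -> bool) (fs : seq (V -> bool)) (v : V) (S : {set I}).

(* The mod 2 cubical cochain df_1 \cup ... \cup df_r, evaluated on the cube with
   least vertex v and edge directions S. *)
Fixpoint cup_delta fs v S : bool :=
  if fs is f :: fs' then
    \sum_(i in S) (f (v + e i) - f v) * cup_delta fs' (v + e i) (S :\ i)
  else 1.

(** The terms at (i, j) and (j, i) cancel mod 2; [enum_rank] picks one of each two. *)
Lemma sum_sym_bool S (a : I -> I -> bool) : (forall i j, a i j = a j i) ->
  \sum_(i in S) \sum_(j in S :\ i) a i j = 0.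
Proof.
move=> a_sym.
pose swap (p : I * I) := (p.2, p.1).
have swapK : involutive swap by case.
rewrite pair_big_dep /=.
rewrite (bigID (fun p : I * I => enum_rank p.1 < enum_rank p.2)%N) /=.
rewrite [X in _ + X](reindex_inj (inv_inj swapK)) /=.
rewrite [X in _ + X](eq_big (fun p : I * I => [&& p.1 \in S, p.2 \in S :\ p.1
   & (enum_rank p.1 < enum_rank p.2)%N]) (fun p => a p.1 p.2)); first last.
- by case=> i j /= _.
- case=> i j /=; rewrite !inE -leqNgt leq_eqVlt [i == j]eq_sym.
  rewrite (inj_eq val_inj) (inj_eq enum_rank_inj) [j == i]eq_sym.
  by case: (i == j); case: (i \in S); case: (j \in S) => //=; rewrite ?andbF.
under eq_bigl do rewrite -andbA.
exact: addbb.
Qed.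

Lemma addr_bool (x : bool) : x + x = 0. Proof. exact: addbb. Qed.

(* Mod 2, this says that the coboundary of the cochain vanishes. *)
Lemma cup_delta_closed fs v S :
  \sum_(i in S) cup_delta fs (v + e i) (S :\ i) =
  \sum_(i in S) cup_delta fs v (S :\ i).
Proof.
elim: fs v S => [|f fs IH] v S //=.
have oppb (x : bool) : - x = x by [].
pose w x i j := cup_delta fs x (S :\ i :\ j).
have wC x i j : w x i j = w x j i by rewrite /w !finset.setDDl finset.setUC.
have IH' j x : j \in S ->
    \sum_(i in S :\ j) w (x + e i) j i = \sum_(i in S :\ j) w x j i.
  by move=> jS; exact: IH.
have exch (a : I -> I -> bool) : \sum_(i in S) \sum_(j in S :\ i) a i j =
    \sum_(j in S) \sum_(i in S :\ j) a i j.
  rewrite [LHS](exchange_big_dep (mem S)) /=; last first.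
    by move=> i j _; rewrite !inE => /andP[].
  apply: eq_bigr => j jS; apply: eq_bigl => i.
  by rewrite !inE jS andbT andbC eq_sym.
apply/eqP; rewrite -subr_eq0 oppb -big_split /=.
under eq_bigr => i iS.
  rewrite -big_split /=.
  under eq_bigr => j jS.
    rewrite !oppb !mulrDl -/(w _ i j) -/(w _ i j).
    over.
  rewrite !big_split /=.
  over.
rewrite !big_split /=.
(* The four sums carry the values of [f] at v + e i + e j, v + e i, v + e j and v. [A] is symmetric
   in i and j; the induction hypothesis makes [D] symmetric as well and turns [C] into [B]. *)
set A := (X in X + _ + _); set B := (X in _ + X + _).
set C := (X in _ + (X + _)); set D := (X in _ + (_ + X)).
have -> : A = 0.
  apply: sum_sym_bool => i j.
  by rewrite wC -!addrA [e j + e i]addrC.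
have -> : D = 0.
  rewrite /D exch.
  under eq_bigr => j jS.
    rewrite -mulr_sumr; under eq_bigr do rewrite wC.
    rewrite -IH' // mulr_sumr.
    over.
  apply: sum_sym_bool => i j.
  by rewrite wC -!addrA [e j + e i]addrC.
have -> : C = B.
  rewrite /C exch.
  apply: eq_bigr => j jS.
  rewrite -!mulr_sumr; congr (_ * _).
  by under eq_bigr do rewrite wC; rewrite -IH'.
by rewrite add0r addr0 addr_bool.
Qed.

(** A factor whose function is constant along the edges kills the product. [P] cuts out the vertices
    where this is known; below, it is a face of the grid. *)
Lemma cup_delta_eq0 (J : eqType) (F : J -> V -> bool) (s : seq J) v S j
    (P : V -> Prop) : j \in s ->
    (forall u i, i \in S -> P u -> P (u + e i) /\ F j (u + e i) = F j u) ->
  P v -> cup_delta (map F s) v S = 0.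
Proof.
elim: s v S => [//|g s IH] v S /=; rewrite inE => jgs PF Pv.
rewrite big1 // => i iS; case/predU1P: jgs => [<-|js].
  by rewrite (PF _ _ iS Pv).2 subrr mul0r.
rewrite (IH (v + e i) (S :\ i)) ?mulr0 //; last exact: (PF _ _ iS Pv).1.
by move=> u l; rewrite !inE => /andP[_ lS] Pu; exact: PF.
Qed.

End cubical_cup_product.

(** * A parity count on the grid *)

Section cubical_sperner.
Variables (I : finType) (k : nat).
Local Notation V := {ffun I -> 'I_k.+2}.
Implicit Types (S : {set I}) (u v : V).

Definition unit_step (i : I) : V := [ffun j => if j == i then 1 else 0].

(* Grid vertices are added cyclically. Since u i != ord_max for i in S, the
   S-cube at a low corner u does not wrap around; off S the corner lies on the
   upper faces. *)
Definition low_corner S u :=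
  [forall i, if i \in S then u i != ord_max else u i == ord_max].

Definition low_corner_off j S u :=
  [forall i, (i != j) ==> (if i \in S then u i != ord_max else u i == ord_max)].

Lemma low_cornerE j S u : j \in S ->
  low_corner S u = low_corner_off j S u && (u j != ord_max).
Proof.
move=> jS; apply/forallP/andP => [Su|[/forallP Su uj] i].
  split; last by have := Su j; rewrite jS.
  by apply/forallP => i; apply/implyP => _; exact: Su.
have [->|ij] := eqVneq i j; first by rewrite jS.
exact: (implyP (Su i)).
Qed.

Lemma low_cornerD1E j S u : j \in S ->
  low_corner (S :\ j) u = low_corner_off j S u && (u j == ord_max).
Proof.
move=> jS; apply/forallP/andP => [Su|[/forallP Su uj] i].
  split; last by have := Su j; rewrite !inE eqxx.
  by apply/forallP => i; apply/implyP => ij; have := Su i; rewrite !inE ij.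
rewrite !inE; have [->|ij] := eqVneq i j; first by [].
exact: (implyP (Su i)).
Qed.

Lemma low_corner_subE j S u : j \in S ->
  low_corner S (u - unit_step j) = low_corner_off j S u && (u j != 0).
Proof.
move=> jS; rewrite (low_cornerE _ jS); congr (_ && _).
  apply/forallP/forallP => Su i; apply/implyP => ij; have := implyP (Su i) ij;
  by rewrite !ffunE (negbTE ij) subr0.
rewrite !ffunE eqxx subr_eq; congr (~~ (_ == _)).
by apply/val_inj; rewrite /= modnDmr addn1 modnn.
Qed.

(** Mod 2 telescoping in direction j: the shifted sum runs over u j != 0, the other over u j !=
    [ord_max], so only the two end slices survive. *)
Lemma sum_shift j S (g : V -> bool) : j \in S ->
  \sum_(u | low_corner S u) g (u + unit_step j) + \sum_(u | low_corner S u) g u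
  = \sum_(u | low_corner_off j S u && (u j == 0)) g u +
    \sum_(u | low_corner (S :\ j) u) g u.
Proof.
move=> jS; rewrite (reindex_inj (addIr (- unit_step j))) /=.
under eq_bigr do rewrite subrK.
under eq_bigl do rewrite low_corner_subE //.
under [X in _ + X = _]eq_bigl do rewrite (low_cornerE _ jS).
under [X in _ = _ + X]eq_bigl do rewrite low_cornerD1E //.
set d := low_corner_off j S.
have : \sum_(u | d u && (u j == 0)) g u + \sum_(u | d u && (u j != 0)) g u =
    \sum_(u | d u && (u j == ord_max)) g u +
    \sum_(u | d u && (u j != ord_max)) g u.
  by rewrite -!bigID.
move: (\sum_(u | _) _) (\sum_(u | _) _) (\sum_(u | _) _) (\sum_(u | _) _).
by do 4!case.
Qed.

(** Induction by Stokes: as the product w over [s] is closed, dF_i times w is the coboundary of F_i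
    w, and the sum moves to the boundary. On the j-th faces with j != i, w vanishes because F_j is
    constant there; on the lower i-th face F_i is 0; the upper i-th face gives the sum for [s]. *)
Theorem cubical_sperner_sum (F : I -> V -> bool) (s : seq I) :
    (forall i u, u i = 0 -> F i u = false) ->
    (forall i u, u i = ord_max -> F i u = true) -> uniq s ->
  \sum_(u | low_corner [set i in s] u)
    cup_delta unit_step (map F s) u [set i in s] = 1.
Proof.
move=> F0 F1; elim: s => [_|i s IH] /=.
  rewrite (big_pred1 [ffun=> ord_max]) // => u /=.
  apply/forallP/eqP => [Su|-> j]; last by rewrite inE ffunE eqxx.
  by apply/(ffunP (_ : V) (_ : V)) => j; rewrite ffunE; have := Su j; rewrite inE => /eqP.
move=> /andP[is' us]; set S := [set j in i :: s].
have iS : i \in S by rewrite !inE eqxx.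
have SDi : S :\ i = [set j in s].
  apply/setP => j; rewrite !inE; case: eqVneq => [->|//].
  by rewrite (negbTE is').
pose g j u := F i u * cup_delta unit_step (map F s) u (S :\ j).
transitivity (\sum_(j in S) (\sum_(u | low_corner S u) g j (u + unit_step j) +
   \sum_(u | low_corner S u) g j u)).
  rewrite big_split /= [X in _ = X + _]exchange_big [X in _ = _ + X]exchange_big.
  rewrite -big_split /=.
  apply: eq_bigr => u _.
  rewrite -[X in _ + X]mulr_sumr -cup_delta_closed mulr_sumr -big_split /=.
  by apply: eq_bigr => j jS; rewrite mulrDl.
under eq_bigr => j jS do rewrite sum_shift //.
have face0 j u : j \in S -> j != i -> u j = 0 \/ u j = ord_max -> g j u = 0.
  move=> jS ji uj; rewrite /g.
  have js : j \in s by move: jS; rewrite !inE (negbTE ji).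
  rewrite (@cup_delta_eq0 _ _ _ _ F s u _ j (fun w => w j = u j)) ?mulr0 //.
  move=> w l; rewrite !inE => /andP[lj _] wj.
  have wlj : (w + unit_step l) j = u j.
    by rewrite !ffunE eq_sym (negbTE lj) addr0.
  by split => //; case: uj wj wlj => -> wj wlj; rewrite ?(F0 _ _ wj) ?(F0 _ _ wlj)
    ?(F1 _ _ wj) ?(F1 _ _ wlj).
rewrite (bigD1 i) //= [X in _ + X]big1 ?addr0.
  rewrite [X in X + _]big1 ?add0r.
    rewrite SDi -[RHS]IH //; apply: eq_bigr => u.
    rewrite -SDi low_cornerD1E // => /andP[_ /eqP ui].
    by rewrite /g F1 // mul1r.
  by move=> u /andP[_ /eqP ui]; rewrite /g F0 // mul0r.
move=> j /andP[jS ji]; rewrite !big1 ?addr0 // => u.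
  by rewrite low_cornerD1E // => /andP[_ /eqP uj]; apply: face0 => //; right.
by move=> /andP[_ /eqP uj]; apply: face0 => //; left.
Qed.

End cubical_sperner.

(** Some summand of a nonzero value is nonzero. It is a path of edges in the cube on which each
    function of [s] changes along its own edge; [T] and [U] encode the ends of the edge of F j. *)
Lemma cup_delta_neq0 (I : finType) (V : zmodType) (e : I -> V) (J : eqType)
    (F : J -> V -> bool) (s : seq J) v (S : {set I}) j :
    j \in s -> cup_delta e (map F s) v S ->
  exists T U : {set I}, [/\ T \subset S, U \subset S &
    F j (v + \sum_(i in T) e i) != F j (v + \sum_(i in U) e i)].
Proof.
elim: s v S => [//|g s IH] v S /=; rewrite inE => jgs.
pose term i := (F g (v + e i) - F g v) * cup_delta e (map F s) (v + e i) (S :\ i).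
have [i /andP[iS]|no] := pickP (fun i => (i \in S) && term i); last first.
  by rewrite big1 // => i iS; have := no i; rewrite iS.
move=> /andP[Fi wi] _; case/predU1P: jgs => [->|js].
  exists [set i]%SET, finset.set0; rewrite big_set1 big_set0 addr0 finset.sub1set iS.
  rewrite finset.sub0set; split=> //.
  by move: Fi; case: (F g (v + e i)); case: (F g v).
have [T [U [TS US FTU]]] := IH _ _ js wi.
have addi (W : {set I}) : W \subset S :\ i ->
    i |: W \subset S /\ v + \sum_(l in i |: W) e l = v + e i + \sum_(l in W) e l.
  rewrite finset.subsetD1 => /andP[WS iW]; rewrite big_setU1 //= addrA.
  by rewrite finset.subUset finset.sub1set iS.
have [iTS iTE] := addi _ TS; have [iUS iUE] := addi _ US.
by exists (i |: T)%SET, (i |: U)%SET; rewrite iTE iUE.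
Qed.

Section grid.
Variables (I : finType) (k : nat).
Local Notation V := {ffun I -> 'I_k.+2}.

Lemma grid_vertex (u : V) (T : {set I}) : (forall i, u i != ord_max) ->
  forall i, (u + \sum_(j in T) unit_step k j) i = (u i + (i \in T))%N :> nat.
Proof.
move=> umax i; have -> : (u + \sum_(j in T) unit_step k j) i =
    u i + (if i \in T then 1 else 0).
  rewrite ffunE; congr (_ + _); rewrite sum_ffunE; under eq_bigr do rewrite ffunE.
  case: ifPn => iT; last first.
    by rewrite big1 // => j jT; case: eqP => // ij; rewrite ij jT in iT.
  rewrite (bigD1 i) //= eqxx big1 ?addr0 // => j /andP[_].
  by rewrite eq_sym => /negbTE ->.
have ui : (u i < k.+1)%N.
  by have := umax i; rewrite -val_eqE /= ltn_neqAle => ->; rewrite -ltnS ltn_ord.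
case: (i \in T); last by rewrite addr0 addn0.
by rewrite /= modn_small addn1.
Qed.

Theorem cubical_sperner (F : I -> V -> bool) :
    (forall i (u : V), u i = 0 -> F i u = false) ->
    (forall i (u : V), u i = ord_max -> F i u = true) ->
  exists u : V, forall i, exists a b : V, [/\ F i a, ~~ F i b,
    forall j, (u j <= a j <= (u j).+1)%N & forall j, (u j <= b j <= (u j).+1)%N].
Proof.
move=> F0 F1; have := cubical_sperner_sum F0 F1 (enum_uniq I).
set S := [set i in enum I]%SET => sum1.
have [u Su cu] : exists2 u : V, low_corner S u &
    cup_delta (@unit_step I k) (map F (enum I)) u S.
  case: (pickP (fun u : V => low_corner S u &&
    cup_delta (@unit_step I k) (map F (enum I)) u S)).
    by move=> u /andP[]; exists u.
  move=> no; have: false = true :> bool; last by [].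
  by rewrite -[RHS]sum1 big1 // => u Su; have := no u; rewrite Su.
have umax i : u i != ord_max.
  by have := forallP Su i; rewrite inE mem_enum.
exists u => i; have [|T [U [_ _]]] := cup_delta_neq0 _ cu (j := i).
  by rewrite mem_enum.
have vtx (W : {set I}) j :
    (u j <= (u + \sum_(l in W) unit_step k l)%R j <= (u j).+1)%N.
  by rewrite grid_vertex //; case: (j \in W); rewrite /= ?addn1 ?addn0 leqnn leqnSn.
case FT: (F i _); case FU: (F i _) => // _.
- by exists (u + \sum_(l in T) unit_step k l), (u + \sum_(l in U) unit_step k l);
    rewrite FT FU; split.
- by exists (u + \sum_(l in U) unit_step k l), (u + \sum_(l in T) unit_step k l);
    rewrite FT FU; split.
Qed.

End grid.

(** * From the grid to the continuous zero theorem *)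

Section poincare_miranda.
Variables (R : realType) (N : nat).

Definition unit_cube : set 'rV[R]_N := [set x | forall i, 0 <= x 0 i <= 1].

Lemma compact_unit_cube : compact unit_cube.
Proof.
rewrite (_ : unit_cube = [set x : 'rV_N | forall i, `[0, 1]%classic (x 0 i)]).
  by apply: (@rV_compact R N (fun=> `[0, 1]%classic)) => _; exact: segment_compact.
by apply/seteqP; split => x /= xc i; have := xc i; rewrite /= in_itv.
Qed.

Definition grid_point k (u : {ffun 'I_N -> 'I_k.+2}) : 'rV[R]_N :=
  \row_i ((u i)%:R / k.+1%:R).

Lemma grid_point_unit k (u : {ffun 'I_N -> 'I_k.+2}) : unit_cube (grid_point u).
Proof.
move=> i; rewrite mxE divr_ge0 ?ler0n //= ler_pdivrMr ?ltr0n // mul1r ler_nat.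
by rewrite -ltnS ltn_ord.
Qed.

Lemma grid_point_ball k (u a : {ffun 'I_N -> 'I_k.+2}) r : k.+1%:R^-1 < r ->
  (forall j, (u j <= a j <= (u j).+1)%N) -> ball (grid_point u) r (grid_point a).
Proof.
move=> kr ua; have k0 : 0 < k.+1%:R^-1 :> R by rewrite invr_gt0 ltr0n.
split=> [|i j]; first exact: lt_trans kr.
have /andP[uaj auj] := ua j.
rewrite /ball /= !mxE -mulrBl -opprB mulNr normrN -natrB // ger0_norm; last first.
  by rewrite mulr_ge0 ?ler0n // ltW.
apply: le_lt_trans kr; rewrite ler_piMl ?(ltW k0) //.
have : (a j - u j <= 1)%N by rewrite leq_subLR addn1.
by rewrite -(ler_nat R).
Qed.

(** Cells on which every F i takes both weak signs cluster at a point p as the mesh shrinks. If F i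
    p were nonzero, F i would keep a strict sign on the cells near p. *)
Theorem poincare_miranda (F : 'I_N -> 'rV[R]_N -> R) :
    (forall i, continuous (F i)) ->
    (forall i x, unit_cube x -> x 0 i = 0 -> F i x <= 0) ->
    (forall i x, unit_cube x -> x 0 i = 1 -> 0 <= F i x) ->
  exists2 x, unit_cube x & forall i, F i x = 0.
Proof.
move=> Fc F0 F1.
have cells k : exists u : {ffun 'I_N -> 'I_k.+2}, forall i,
    exists a b : {ffun 'I_N -> 'I_k.+2},
    [/\ 0 <= F i (grid_point a), F i (grid_point b) <= 0,
    forall j, (u j <= a j <= (u j).+1)%N & forall j, (u j <= b j <= (u j).+1)%N].
  (* The labels are signs, forced to false on the lower faces and to true on the upper ones; the
     boundary hypotheses make the forced labels agree with weak signs. *)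
  have [||u uP] := @cubical_sperner 'I_N k (fun i u =>
      (u i != 0) && ((u i == ord_max) || (0 < F i (grid_point u)))).
  - by move=> i u ->; rewrite eqxx.
  - by move=> i u ->; rewrite eqxx andbT.
  exists u => i; have [a [b [Fa Fb ua ub]]] := uP i; exists a, b; split => //.
    case/andP: Fa => _ /orP[/eqP am|/ltW //].
    apply: F1; first exact: grid_point_unit.
    by rewrite mxE am /= divff // pnatr_eq0.
  move: Fb; rewrite negb_and negbK negb_or -leNgt => /orP[/eqP b0|/andP[] //].
  by apply: F0; [exact: grid_point_unit | rewrite mxE b0 mul0r].
pose u_ k := projT1 (cid (cells k)).
have u_P k := projT2 (cid (cells k)); rewrite -/(u_ _) in u_P.
have [|p [pc pcl]] := compact_unit_cube (F := (fun k => grid_point (u_ k)) @ \oo) _.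
  by exists 0%N => // k _; exact: grid_point_unit.
exists p => // i; apply/eqP/negPn/negP => Fp0.
have /nbhs_ballP[r r0 rP] : nbhs p (fun y => `|F i p - F i y| < `|F i p|).
  by have /cvgrPdist_lt := Fc i p; apply; rewrite normr_gt0.
have r2 : 0 < r / 2 by rewrite divr_gt0.
have [K KP] : exists K, forall k, (K <= k)%N -> k.+1%:R^-1 < r / 2.
  exists (Num.trunc (r / 2)^-1) => k kK.
  rewrite invf_plt ?posrE ?ltr0n //.
  apply: lt_le_trans (truncnS_gt _) _.
  by rewrite ler_nat ltnS.
have [_ [[k Kk <-] pk]] : [set grid_point (u_ k) | k in [set k | (K <= k)%N]] `&`
   ball p (r / 2) !=set0.
  apply: pcl; last exact: nbhsx_ballx.
  by exists K => // k Kk; exists k.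
have [a [b [Fa Fb ua ub]]] := u_P k i.
have near (w : {ffun 'I_N -> 'I_k.+2}) : (forall j, (u_ k j <= w j <= (u_ k j).+1)%N) ->
    `|F i p - F i (grid_point w)| < `|F i p|.
  move=> uw; apply: rP; rewrite [r]splitr.
  by apply: ball_triangle pk _; apply: grid_point_ball => //; exact: KP.
have := near _ ua; have := near _ ub.
by case: (ltrgt0P (F i p)) Fp0 => // Fp _; rewrite !ltr_norml => /andP[? ?] /andP[? ?];
  lra.
Qed.

End poincare_miranda.

(** * Ternary digits of the points of the Menger space *)

Lemma exists_superset_card (T : finType) (A : {set T}) n :
    (#|A| <= n)%N -> (n <= #|T|)%N ->
  exists B : {set T}, (A \subset B) && (#|B| == n).
Proof.
move=> An nT; have /card_geqP[s [us ss sA]] : (n - #|A| <= #|(~: A)%SET|)%N.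
  by rewrite [#|(~: A)%SET|]cardsCs finset.setCK leq_sub2r.
exists (A :|: [set x in s])%SET; rewrite finset.subsetUl cardsU /=.
rewrite (_ : A :&: _ = finset.set0)%SET ?cards0.
  by rewrite subn0 cardsE (card_uniqP us) ss subnKC.
apply/setP => x; rewrite !inE; apply/negbTE/negP => /andP[xA /sA].
by rewrite inE xA.
Qed.

Section menger_digits.
Variable R : realType.
Implicit Types (t : R) (l j n : nat).

(** The inequalities are strict because an end of a middle third also belongs to an outer third. *)
Definition middle l t : bool :=
  `[< exists k : nat, (k * 3).+1%:R < 3 ^+ l.+1 * t < (k * 3).+2%:R >].

Definition middle_set m l (x : 'rV[R]_m) : {set 'I_m} :=
  [set i | middle l (x 0 i)]%SET.

Lemma exp3_gt0 j : 0 < 3 ^+ j :> R. Proof. by rewrite exprn_gt0. Qed.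

Lemma exp3_neq0 j : 3 ^+ j != 0 :> R. Proof. by rewrite lt0r_neq0 ?exp3_gt0. Qed.

Lemma exp3_nat j : 3 ^+ j = (3 ^ j)%N%:R :> R. Proof. by rewrite natrX. Qed.

Lemma not_middle l t (z : nat) : (z %% 3 != 1)%N ->
  z%:R <= 3 ^+ l.+1 * t <= z.+1%:R -> middle l t = false.
Proof.
move=> z3 /andP[zt tz]; apply/negbTE/asboolPn => -[k /andP[kt tk]].
have: (k * 3).+1%:R < z.+1%:R :> R by exact: lt_le_trans tz.
have: z%:R < (k * 3).+2%:R :> R by exact: le_lt_trans tk.
by rewrite !ltr_nat; lia.
Qed.

Lemma stage_corner_nat n j (a : 'rV[R]_(n.*2.+1)) i : stage_corners n j a ->
  exists z : nat, 3 ^+ j * a 0 i = z%:R.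
Proof.
elim: j a => [a -> /=|j IH _ [a [k [/IH[z az] -> _]]]].
  by exists 0%N; rewrite mxE mulr0.
exists (z * 3 + k i)%N; rewrite mxE natrD natrM -az exprS.
have := exp3_neq0 j => ?; field.
by [].
Qed.

Lemma menger_unit n x : menger_set R n x -> forall i, 0 <= x 0 i <= 1.
Proof.
move=> /(_ 0%N Logic.I)[_ /= -> x01] i.
by have := x01 i; rewrite mxE add0r expr0 invr1.
Qed.

(** The subcube containing x meets a face with n free coordinates. A coordinate fixed on that face
    is at an end of the parent edge, so the subcube has digit 0 or 2 there and x avoids the middle
    third. *)
Lemma menger_middle n x l : menger_set R n x ->
  (#|middle_set l x| <= n)%N.
Proof.
move=> /(_ l.+1 Logic.I)[_ /= [a [k [sa -> [y [yb [F /= F_n [E _ [_ yF]]]]]]]] xb].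
apply: (@leq_trans #|F|); last by rewrite F_n.
apply: subset_leq_card; apply/fintype.subsetP => i; rewrite inE.
apply: contraTT => iF.
have [z az] := stage_corner_nat i sa.
have := yb i; have := xb i; have := yF i iF; rewrite !mxE.
have p0 := exp3_gt0 l; have pn := exp3_neq0 l.
have aE : a 0 i = z%:R / 3 ^+ l by rewrite -az mulrC mulKf.
set s := 3 ^- l; have s0 : 0 < s by rewrite invr_gt0.
rewrite [3 ^- l.+1](_ : _ = s / 3); last by rewrite exprS invfM mulrC.
have zE : 3 ^+ l.+1 * (a 0 i + (k i)%:R * (s / 3)) = (z * 3 + k i)%:R.
  by rewrite aE exprS natrD natrM /s; field.
have zE' : 3 ^+ l.+1 * (a 0 i + (k i)%:R * (s / 3) + s / 3) = (z * 3 + k i).+1%:R.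
  by rewrite mulrDr zE -[RHS]natr1 exprS /s; congr (_ + _); field.
move=> yi /andP[x1 x2] /andP[y1 y2].
rewrite (@not_middle _ _ (z * 3 + k i)) //; last first.
  by rewrite -zE -zE' !ler_pM2l ?x1 ?x2 // exp3_gt0.
rewrite modnMDl modn_small //; apply/eqP => ki1.
by move: yi y1 y2; rewrite ki1; case: ifP => _ ->; lra.
Qed.

(** Ties are resolved away from the digit 1, which thus occurs only strictly inside a middle
    third. *)
Fixpoint digit_floor j t : nat :=
  if j is j'.+1 then
    let z := (digit_floor j' t * 3)%N in
    if 3 ^+ j * t <= z.+1%:R then z else if 3 ^+ j * t < z.+2%:R then z.+1 else z.+2
  else 0.

Lemma digit_floorP j t : 0 <= t <= 1 ->
  (digit_floor j t)%:R <= 3 ^+ j * t <= (digit_floor j t).+1%:R.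
Proof.
move=> t01; elim: j => [|j /andP[IH1 IH2]]; first by rewrite expr0 mul1r.
rewrite [digit_floor _ _]/=; set z := (_ * 3)%N.
have z1 : z%:R <= 3 ^+ j.+1 * t by rewrite natrM exprS; lra.
have z2 : 3 ^+ j.+1 * t <= z.+3%:R.
  by move: IH2; rewrite /z -!natr1 natrM exprS; lra.
case: ifPn => [->|]; first by rewrite z1.
rewrite -ltNge => /ltW z3; case: ifPn => [/ltW ->|]; first by rewrite z3.
by rewrite -leNgt => ->.
Qed.

Lemma digit_floorS j t : 0 <= t <= 1 -> exists k : 'I_3,
  digit_floor j.+1 t = (digit_floor j t * 3 + k)%N /\
  (k == 1%N :> nat -> middle j t).
Proof.
move=> t01; rewrite [digit_floor j.+1 _]/=; set z := (_ * 3)%N.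
case: ifPn => [_|]; first by exists ord0; rewrite addn0.
rewrite -ltNge => z1; case: ifPn => [z2|_].
  exists (inord 1); rewrite inordK // addn1; split=> // _.
  by apply/asboolP; exists (digit_floor j t); rewrite z1.
by exists (inord 2); rewrite inordK // addn2.
Qed.

(* A point of the skeleton in each digit cube: the n coordinates containing all
   the middle digits are left free, and every other coordinate is pushed to the
   face of the parent cube that it touches. *)
Lemma mengerP n (x : 'rV[R]_(n.*2.+1)) : (forall i, 0 <= x 0 i <= 1) ->
    (forall l, (#|middle_set l x| <= n)%N) -> menger_set R n x.
Proof.
move=> x01 xm j _.
pose b j : 'rV[R]_(n.*2.+1) := \row_i ((digit_floor j (x 0 i))%:R / 3 ^+ j).
exists (b j); last first.
  move=> i; rewrite mxE; have /andP[h1 h2] := digit_floorP j (x01 i).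
  rewrite ler_pdivrMr ?exp3_gt0 // mulrC h1 /= -[X in _ <= _ + X]mul1r -mulrDl.
  by rewrite natr1 ler_pdivlMr ?exp3_gt0 // mulrC.
elim: j => [|j IH] /=; first by apply/rowP => i; rewrite !mxE mul0r.
have kP i := cid (digit_floorS j (x01 i)).
pose k : {ffun 'I_(n.*2.+1) -> 'I_3} := [ffun i => projT1 (kP i)].
have kE i : digit_floor j.+1 (x 0 i) = (digit_floor j (x 0%R i) * 3 + k i)%N.
  by rewrite ffunE; case: (projT2 (kP i)).
have k1 i : k i == 1%N :> nat -> middle j (x 0 i).
  by rewrite ffunE; case: (projT2 (kP i)).
have p0 := exp3_gt0 j; have pn := exp3_neq0 j.
have s0 : 0 < 3 ^- j :> R by rewrite invr_gt0.
have sE : 3 ^- j.+1 = 3 ^- j / 3 :> R by rewrite exprS invfM mulrC.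
have bE : b j.+1 = subcorner (b j) (3 ^- j) k.
  by apply/rowP => i; rewrite !mxE kE natrD natrM exprS; field.
exists (b j), k; split => //.
have [F /andP[FS /eqP Fn]] : exists F : {set 'I_n.*2.+1},
    (middle_set j x \subset F) && (#|F| == n).
  apply: exists_superset_card; first exact: xm.
  by rewrite card_ord -addnn -addnS leq_addr.
pose E := [set i | k i == 2%N :> nat]%SET.
exists (\row_i (b j 0 i + (if i \in F then (k i)%:R / 3 else (i \in E)%:R) * 3 ^- j)).
have ki i : ((k i) <= 2)%N by rewrite -ltnS ltn_ord.
split.
- move=> i; rewrite bE sE !mxE; case: ifPn => iF; first by lra.
  have : (k i != 1 :> nat)%N.
    by apply: contraNN iF => /k1 mi; apply: (fintype.subsetP FS); rewrite inE.
  rewrite inE; case: (nat_of_ord (k i)) (ki i) => [|[|[|]]] //= _ _; lra.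
- exists F => //; exists E => //; split=> [i|i iF]; rewrite !mxE.
    case: ifPn => iF.
      have k0 : 0 <= (k i)%:R :> R by rewrite ler0n.
      have k2 : (k i)%:R <= 2 :> R by rewrite ler_nat.
      by nra.
    by case: (i \in E) => /=; lra.
  by rewrite (negbTE iF); case: (i \in E) => /=; lra.
Qed.
End menger_digits.

(** * The Menger space is not contractible *)

Section continuity.
Variable R : realType.

Lemma continuous_rV (T : topologicalType) m (f : T -> 'rV[R]_m) :
  (forall i, continuous (fun x => f x 0 i)) -> continuous f.
Proof.
move=> fc x U [P fxP PU].
have : \forall y \near x, forall i : 'I_1, forall j : 'I_m, P i j (f y i j).
  apply: filter_forall => i; apply: filter_forall => j; rewrite [i]ord1.
  by apply: fc; have := fxP 0 j.
by apply: filterS => y Py; apply: PU.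
Qed.

Section real_functions.
Variables (T : topologicalType) (f g : T -> R).
Hypotheses (fc : continuous f) (gc : continuous g).

Lemma fun_continuousD : continuous (fun x => f x + g x).
Proof. by move=> x; exact: (cvgD (@fc x) (@gc x)). Qed.

Lemma fun_continuousB : continuous (fun x => f x - g x).
Proof. by move=> x; exact: (cvgB (@fc x) (@gc x)). Qed.

Lemma fun_continuousM : continuous (fun x => f x * g x).
Proof. by move=> x; exact: (cvgM (@fc x) (@gc x)). Qed.

Lemma fun_continuous_norm : continuous (fun x => `|f x|).
Proof. by move=> x; exact: (cvg_norm (@fc x)). Qed.

Lemma continuous_min1 : continuous (fun x => Num.min 1 (f x)).
Proof.
by move=> x; apply: (@continuous_min R T (cst 1) f); [exact: cst_continuous|exact: fc].
Qed.

Lemma fun_continuousV : (forall x, f x != 0) -> continuous (fun x => (f x)^-1).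
Proof. by move=> f0 x; exact: (cvgV (f0 x) (@fc x)). Qed.

End real_functions.

Definition clamp (t : R) : R := Num.max 0 (Num.min 1 t).

Lemma clamp_itv t : 0 <= clamp t <= 1.
Proof. by rewrite /clamp ge_max le_max lexx ler01 ge_min lexx. Qed.

Lemma clamp_le0 t : t <= 0 -> clamp t = 0.
Proof.
move=> t0; rewrite /clamp max_l // ge_min t0 orbT //.
Qed.

Lemma clamp_ge1 t : 1 <= t -> clamp t = 1.
Proof. by move=> t1; rewrite /clamp min_l // max_r // ler01. Qed.

Lemma continuous_clamp : continuous clamp.
Proof.
move=> t; apply: (@continuous_max R R (cst 0) (fun t => Num.min 1 t)).
  exact: cst_continuous.
by apply: (@continuous_min R R (cst 1) id); [exact: cst_continuous|exact: cvg_id].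
Qed.

Lemma continuous_clamp_comp (T : topologicalType) (f : T -> R) :
  continuous f -> continuous (fun x => clamp (f x)).
Proof.
move=> fc x.
exact: (@continuous_comp _ _ _ f clamp x (fc x) (@continuous_clamp _)).
Qed.

(** Clamping the time to [0, 1] makes the homotopy continuous on the whole product. *)
Lemma continuous_homotopy (A X : topologicalType) (f g : A -> X) :
  homotopic R f g -> exists H : A * R -> X,
    [/\ continuous H, forall a, H (a, 0) = f a & forall a, H (a, 1) = g a].
Proof.
move=> [H [Hc H0 H1]]; exists (fun p => H (p.1, clamp p.2)); split => [p|a|a] /=.
- move/subspace_continuousP: Hc => /(_ (p.1, clamp p.2)) Hp.
  have Bp q : ([set: A] `*` `[0 : R, 1]) (q.1, clamp q.2).
    by split => //=; rewrite in_itv /= clamp_itv.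
  move=> U /(Hp (Bp p)) HU.
  have: (fun q : A * R => (q.1, clamp q.2)) @ p --> (p.1, clamp p.2).
    have c1 : q.1 @[q --> p] --> p.1 by exact: cvg_fst.
    have c2 : clamp q.2 @[q --> p] --> clamp p.2.
      apply: (@cvg_comp _ _ _ (@snd A R) clamp _ (nbhs p.2)).
        exact: cvg_snd.
      exact: continuous_clamp.
    exact: (cvg_pair c1 c2).
  move=> /(_ _ HU) cHU; apply: (@filterS _ (nbhs p) _ _ _ _ cHU) => q /= Hq.
  exact: (Hq (Bp q)).
- by rewrite clamp_le0.
- by rewrite clamp_ge1.
Qed.

End continuity.

Section not_contractible.
Variables (R : realType) (n : nat).
Local Notation m := n.*2.+1.
Local Notation N := n.+1.
Local Notation X := (menger_space R n).

Lemma head_proof : (N <= m)%N. Proof. by rewrite ltnS -addnn leq_addr. Qed.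

Definition head_ord : 'I_N -> 'I_m := widen_ord head_proof.

Definition pad (z : 'rV[R]_N) : 'rV[R]_m :=
  \row_i (if (i < N)%N then z 0 (inord i) else 0).

Lemma pad_head z i : pad z 0 (head_ord i) = z 0 i.
Proof. by rewrite mxE /= ltn_ord inord_val. Qed.

Lemma not_middle01 l (t : R) : t = 0 \/ t = 1 -> middle l t = false.
Proof.
case=> ->.
  by apply: (@not_middle _ _ _ 0%N) => //; rewrite mulr0 lexx ler0n.
apply: (@not_middle _ _ _ (3 ^ l.+1)%N); first by rewrite expnS mulnC modnMl.
by rewrite mulr1 exp3_nat lexx ler_nat leqnSn.
Qed.

(** The values 0 and 1 avoid every middle third, which leaves at most n coordinates of [z] that can
    lie in one. *)
Lemma menger_pad z i : unit_cube z -> z 0 i = 0 \/ z 0 i = 1 ->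
  menger_set R n (pad z).
Proof.
move=> z01 zi; apply: mengerP => [j|l].
  by rewrite mxE; case: ifP => _; [exact: z01 | rewrite lexx ler01].
apply: (@leq_trans #|head_ord @: [set~ i]%SET|); last first.
  by rewrite (leq_trans (leq_imset_card _ _)) // cardsC1 card_ord.
apply/subset_leq_card/fintype.subsetP => j; rewrite inE mxE.
case: ifPn => jN jm; last by rewrite not_middle01 // in jm; left.
apply/imsetP; exists (inord j); last by apply/val_inj; rewrite /= inordK.
rewrite !inE; apply: contraTneq jm => ->.
by rewrite not_middle01.
Qed.

(** Otherwise n + 1 coordinates would lie in the middle third of level 0. *)
Lemma menger_head x : menger_set R n x -> exists i, x 0 (head_ord i) != 1 / 2.
Proof.
move=> xm; have [[i xi]|no] := pselect (exists i, x 0 (head_ord i) != 1 / 2).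
  by exists i.
have : (#|head_ord @: [set: 'I_N]%SET| <= n)%N.
  apply: leq_trans (menger_middle 0 xm); apply/subset_leq_card/fintype.subsetP.
  move=> _ /imsetP[i _ ->]; rewrite inE; apply/asboolP; exists 0%N.
  have -> : x 0 (head_ord i) = 1 / 2.
    by apply/eqP/negPn/negP => xi; apply: no; exists i.
  by rewrite expr1; apply/andP; split; lra.
rewrite card_imset ?cardsT ?card_ord ?ltnn // => i j /(congr1 val) /= ij.
exact: val_inj.
Qed.

(** A contraction would fill the boundary of the (n+1)-face: [K] is constant on an inner cube, runs
    through the contraction on the shell around it, and is the boundary map from the faces of the
    unit cube on. A common zero of the centred coordinates of [K] contradicts [menger_head]. *)
Theorem menger_not_contractible : ~ contractible_in R [set: X].
Proof.
move=> [c /continuous_homotopy[H [Hc H0 H1]]].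
pose h : 'rV[R]_N := const_mx (1 / 2).
(* [z] stretches the cube of radius 1/4 about [h] onto the unit cube and sends everything outside it
   to the boundary. *)
pose z (y : 'rV[R]_N) : 'rV[R]_N := \row_i clamp (2 * y 0 i - 1 / 2).
have zc : continuous z.
  apply: continuous_rV => i.
  have -> : (fun y => z y 0 i) = (fun y : 'rV[R]_N => clamp (2 * y 0 i - 1 / 2)).
    by apply/funext => y; rewrite mxE.
  apply: continuous_clamp_comp; apply: fun_continuousB; last exact: cst_continuous.
  by apply: fun_continuousM; [exact: cst_continuous | exact: coord_continuous].
have z01 y : unit_cube (z y) by move=> i; rewrite mxE clamp_itv.
have padc : continuous (pad \o z).
  apply: continuous_rV => i.
  have -> : (fun y => (pad \o z) y 0 i) =
      (fun y : 'rV[R]_N => if (i < N)%N then z y 0 (inord i) else 0).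
    by apply/funext => y; rewrite mxE.
  case: (i < N)%N; last exact: cst_continuous.
  move=> y; exact: (@continuous_comp _ _ _ z (fun w : 'rV[R]_N => w 0 (inord i)) y
    (zc y) (@coord_continuous _ _ _ _ _ _)).
have coord_le (y : 'rV[R]_N) i : `|y 0 i| <= `|y|.
  rewrite -[leRHS]/(mx_norm y) mx_normrE.
  exact: (le_bigmax _ (fun k : 'I_1 * 'I_N => `|y k.1 k.2|) (0, i)).
have zb y : 1 / 4 <= `|y - h| -> menger_set R n (pad (z y)).
  move=> yh; have /mx_norm_neq0[[a b]] : mx_norm (y - h) != 0.
    by apply: lt0r_neq0; apply: lt_le_trans yh; lra.
  rewrite [a]ord1 -[mx_norm _]/(`|y - h|) => yE.
  apply: (@menger_pad _ b) => //; move: yh; rewrite yE !mxE /=.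
  case: (ger0P (y 0 b - 1 / 2)) => yb.
    by move=> ?; right; rewrite clamp_ge1 //; lra.
  by move=> ?; left; rewrite clamp_le0 //; lra.
pose GX y : X := if pselect (menger_set R n (pad (z y))) is left p
  then exist _ (pad (z y)) (mem_set p) else c.
pose G y : [set: X] := exist _ (GX y) (mem_set Logic.I).
(* Time 1 at distance 1/4 from [h], where [K] must match the constant [c], and time 0 from distance
   1/2 on. *)
pose tau (y : 'rV[R]_N) := clamp (2 - 4 * `|y - h|).
pose far : set 'rV[R]_N := [set y | 1 / 4 <= `|y - h|].
pose close : set 'rV[R]_N := [set y | `|y - h| <= 1 / 4].
have GE y : far y -> set_val (set_val (G y)) = pad (z y).
  by move=> /zb yz; rewrite /G /GX /set_val /=; case: pselect.
have Gc : {within far, continuous G}.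
  apply: continuous_comp_initial; apply: continuous_comp_initial.
  apply: (@subspace_eq_continuous _ far _ (pad \o z)).
    by move=> y /set_mem /GE /= <-.
  exact: continuous_subspaceT.
have distc : continuous (fun y : 'rV[R]_N => `|y - h|).
  by move=> y; exact: (cvg_norm (cvgB cvg_id (cvg_cst h))).
have tauc : continuous tau.
  apply: continuous_clamp_comp; apply: fun_continuousB; first exact: cst_continuous.
  by apply: fun_continuousM; first exact: cst_continuous.
pose K y : X := if 1 / 4 <= `|y - h| then H (G y, tau y) else c.
have Kc : continuous K.
  have farc : closed far.
    by move/continuous_closedP: distc => /(_ _ (@closed_ge R (1 / 4))).
  have closec : closed close.
    by move/continuous_closedP: distc => /(_ _ (@closed_le R (1 / 4))).
  have fcT : far `|` close = [set: 'rV[R]_N].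
    apply/seteqP; split => // y _; rewrite /far /close /=.
    by case: (leP (1 / 4) `|y - h|) => [|/ltW] ?; [left | right].
  apply/continuous_subspace_setT; rewrite -fcT; apply: withinU_continuous => //.
    apply: (@subspace_eq_continuous _ far _ (fun y => H (G y, tau y))).
      by move=> y /set_mem /= yf; rewrite /from_subspace /K ifT.
    have tc : {within far, continuous tau} by exact: continuous_subspaceT.
    move=> y; apply: (@cvg_comp _ _ _ (fun y : subspace far => (G y, tau y)) H
      _ (nbhs (G y, tau y))); last exact: Hc.
    exact: (cvg_pair (@Gc y) (@tc y)).
  apply: (@subspace_eq_continuous _ close _ (cst c)); last exact: cst_continuous.
  move=> y /set_mem /= yc; rewrite /from_subspace /K; case: ifPn => // yf.
  rewrite (_ : tau y = 1) ?H1 // /tau clamp_ge1 //.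
  by move: yc; rewrite /close /=; lra.
pose F (i : 'I_N) y := set_val (K y) 0 (head_ord i) - 1 / 2.
have [|||y _ Fy] := @poincare_miranda R N F.
- move=> i; apply: fun_continuousB; last exact: cst_continuous.
  move=> y; apply: (@continuous_comp _ _ _ K (fun w : X => set_val w 0 (head_ord i))).
    exact: Kc.
  apply: (@continuous_comp _ _ _ (set_val : X -> 'rV[R]_m) (fun w => w 0 (head_ord i))).
    exact: initial_continuous.
  exact: coord_continuous.
- move=> i y y01 yi.
  have yh : 1 / 2 <= `|y - h|.
    by apply: le_trans (coord_le _ i); rewrite !mxE yi sub0r normrN ger0_norm.
  rewrite /F /K ifT; last by lra.
  rewrite /tau clamp_le0; last by lra.
  rewrite H0 GE; last by rewrite /far /=; lra.
  by rewrite pad_head mxE yi clamp_le0; lra.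
- move=> i y y01 yi.
  have yh : 1 / 2 <= `|y - h|.
    apply: le_trans (coord_le _ i); rewrite !mxE yi ger0_norm; lra.
  rewrite /F /K ifT; last by lra.
  rewrite /tau clamp_le0; last by lra.
  rewrite H0 GE; last by rewrite /far /=; lra.
  by rewrite pad_head mxE yi clamp_ge1; lra.
have [i] := menger_head (set_mem (valP (K y))).
by apply/negP; rewrite negbK -subr_eq0; apply/eqP; exact: Fy.
Qed.

End not_contractible.

(** * Stretching windows of the ternary grid *)

Section collapse.
Variables (R : realType) (q : R).
Hypothesis q_mid : 3 / 8 <= q <= 5 / 8.
Implicit Types (e t : R) (j l a b m z : nat).

Lemma sum_indicator M a : (\sum_(m < M) (m < a)%N%:R = (minn M a)%:R :> R)%R.
Proof.
elim: M => [|M IH]; first by rewrite big_ord0 min0n.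
rewrite big_ord_recr /= IH -natrD; congr (_%:R).
by case: (ltnP M a) => /= Ma; lia.
Qed.

(* The map t |-> collapse e j t is monotone and, on each cell of the grid of
   mesh 3 ^- j, it sends everything left (resp. right) of the q-point of the
   cell to its left (resp. right) end, outside a window of radius e. *)
Definition collapse e j t : R :=
  3 ^- j * \sum_(m < 3 ^ j) clamp ((3 ^+ j * t - m%:R - q) / (2 * e) + 1 / 2).

Section window.
Variables (e : R) (e_gt0 : 0 < e) (e_small : e <= 1 / 24).

Lemma ramp0 (y : R) : y <= - e -> clamp (y / (2 * e) + 1 / 2) = 0.
Proof.
move=> ye; apply: clamp_le0.
have : y / (2 * e) <= - (1 / 2); last by lra.
by rewrite ler_pdivrMr ?mulr_gt0 //; lra.
Qed.

Lemma ramp1 (y : R) : e <= y -> clamp (y / (2 * e) + 1 / 2) = 1.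
Proof.
move=> ye; apply: clamp_ge1.
have : 1 / 2 <= y / (2 * e); last by lra.
by rewrite ler_pdivlMr ?mulr_gt0 //; lra.
Qed.

Lemma exp3_collapse j t : 3 ^+ j * collapse e j t =
  \sum_(m < 3 ^ j) clamp ((3 ^+ j * t - m%:R - q) / (2 * e) + 1 / 2).
Proof.
by rewrite mulrA divff ?mul1r // exp3_neq0. Qed.

(** Windows stay inside middle thirds, since 3/8 - 1/24 = 1/3 and 5/8 + 1/24 = 2/3. Hence the ramps
    of all cells left of [a] are complete here, and in [collapse_le] no ramp right of [b] has
    begun. *)
Lemma collapse_ge j a t : (a <= 3 ^ j)%N -> a%:R - 1 / 3 <= 3 ^+ j * t ->
  a%:R <= 3 ^+ j * collapse e j t.
Proof.
have e1 := e_small.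
have /andP[q1 q2] := q_mid; move=> a3 at_.
rewrite exp3_collapse -[in leLHS](minn_idPr a3) -sum_indicator.
apply: ler_sum => m _; case: ltnP => [ma|_]; last by case/andP: (clamp_itv
  ((3 ^+ j * t - m%:R - q) / (2 * e) + 1 / 2)).
have : m.+1%:R <= a%:R :> R by rewrite ler_nat.
by rewrite -natr1 => ?; rewrite ramp1 //; lra.
Qed.

Lemma collapse_le j b t : 3 ^+ j * t <= b%:R + 1 / 3 ->
  3 ^+ j * collapse e j t <= b%:R.
Proof.
have e1 := e_small.
have /andP[q1 q2] := q_mid; move=> tb; rewrite exp3_collapse.
apply: (@le_trans _ _ (minn (3 ^ j) b)%:R); last by rewrite ler_nat geq_minr.
rewrite -sum_indicator.
apply: ler_sum => m _; case: ltnP => [_|bm]; first by case/andP: (clamp_itv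
  ((3 ^+ j * t - m%:R - q) / (2 * e) + 1 / 2)).
have : b%:R <= m%:R :> R by rewrite ler_nat.
by move=> ?; rewrite ramp0 //; lra.
Qed.

Lemma collapse_itv j t : 0 <= t <= 1 -> 0 <= collapse e j t <= 1.
Proof.
move=> /andP[t0 t1]; have p0 := exp3_gt0 R j.
rewrite -(ler_pM2l p0) -[X in _ && X](ler_pM2l p0) mulr0 mulr1.
apply/andP; split.
  by apply: (@collapse_ge _ 0%N) => //; rewrite sub0r; nra.
rewrite [leRHS]exp3_nat; apply: collapse_le; rewrite -exp3_nat; nra.
Qed.

Lemma collapse_dist j t : 0 <= t <= 1 -> `|collapse e j t - t| <= 3 ^- j.
Proof.
move=> /andP[t0 t1]; have p0 := exp3_gt0 R j.
have T0 : 0 <= 3 ^+ j * t by rewrite mulr_ge0 // ltW.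
have /andP[k1 k2] := truncn_itv T0; set k := Num.trunc _ in k1 k2.
have c1 : k%:R <= 3 ^+ j * collapse e j t.
  apply: collapse_ge; last by lra.
  by rewrite -(ler_nat R) -exp3_nat; nra.
have c2 : 3 ^+ j * collapse e j t <= k.+1%:R by apply: collapse_le; lra.
move: k2 c2; rewrite -[k.+1%:R]natr1 => k2 c2.
have : `|3 ^+ j * (collapse e j t - t)| <= 1.
  by rewrite mulrBr ler_norml; apply/andP; split; lra.
by rewrite normrM (gtr0_norm p0) -[3 ^- j]mulr1 ler_pdivlMl.
Qed.

(** For l = j the interval is an outer third of a cell and collapses to an end of that cell. For l <
    j its ends lie on the grid of mesh 3 ^- j, which [collapse] does not cross. *)
Lemma collapse_keep j l z t : 0 <= t <= 1 -> (l <= j)%N -> (z %% 3 != 1)%N ->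
    z%:R <= 3 ^+ l.+1 * t <= z.+1%:R ->
  z%:R <= 3 ^+ l.+1 * collapse e j t <= z.+1%:R.
Proof.
move=> /andP[t0 t1] lj z3 /andP[zt tz].
have p0 := exp3_gt0 R j; have pl := exp3_gt0 R l.+1.
have zl : (z <= 3 ^ l.+1)%N by rewrite -(ler_nat R) -exp3_nat; nra.
move: lj; rewrite leq_eqVlt => /predU1P[lj|lj].
  subst l; have [w zw] : exists w, z = (w * 3)%N \/ z = (w * 3).+2.
    exists (z %/ 3)%N; lia.
  have nS k : k.+1%:R = k%:R + 1 :> R by rewrite natr1.
  case: zw => zw; subst z; move: zt tz; rewrite exprS ?(nS (w * 3).+2)
    ?(nS (w * 3).+1) ?(nS (w * 3)%N) natrM => zt tz.
    have c1 : w%:R <= 3 ^+ j * collapse e j t.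
      by apply: collapse_ge; [rewrite expnS in zl; lia | lra].
    have c2 : 3 ^+ j * collapse e j t <= w%:R by apply: collapse_le; lra.
    by apply/andP; split; lra.
  have c1 : w.+1%:R <= 3 ^+ j * collapse e j t.
    by apply: collapse_ge; [rewrite expnS in zl; lia | rewrite (nS w); lra].
  have c2 : 3 ^+ j * collapse e j t <= w.+1%:R.
    by apply: collapse_le; rewrite (nS w); lra.
  by move: c1 c2; rewrite (nS w) => c1 c2; apply/andP; split; lra.
have [d jd] : exists d, j = (l.+1 + d)%N by exists (j - l.+1)%N; rewrite subnKC.
have jE : 3 ^+ j = 3 ^+ l.+1 * 3 ^+ d :> R by rewrite jd exprD.
have pd := exp3_gt0 R d.
have nE k : (k * 3 ^ d)%N%:R = k%:R * 3 ^+ d :> R by rewrite natrM exp3_nat.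
apply/andP; split; rewrite -(ler_pM2r pd) -nE mulrAC -jE.
  apply: collapse_ge; last by rewrite nE jE; nra.
  by rewrite jd expnD leq_mul2r zl orbT.
by apply: collapse_le; rewrite nE jE; nra.
Qed.

(** Outside the windows each ramp is 0 or 1, so the sum is a count. *)
Lemma collapse_nat j t :
    (forall m, (m < 3 ^ j)%N -> e <= `|3 ^+ j * t - m%:R - q|) ->
  exists z, 3 ^+ j * collapse e j t = z%:R.
Proof.
move=> far; rewrite exp3_collapse.
exists (\sum_(m < 3 ^ j) (0 <= 3 ^+ j * t - m%:R - q)%R)%N.
rewrite natr_sum; apply: eq_bigr => m _.
have := far m (ltn_ord m); case: (ger0P (3 ^+ j * t - m%:R - q)) => _ y.
  by rewrite ramp1.
by rewrite ramp0 // lerNr.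
Qed.

End window.

Lemma continuous_collapse (T : topologicalType) (e u : T -> R) j :
    continuous e -> (forall x, e x != 0) -> continuous u ->
  continuous (fun x => collapse (e x) j (u x)).
Proof.
move=> ec e0 uc; apply: fun_continuousM; first exact: cst_continuous.
apply: continuous_big; first exact: add_continuous.
move=> m _; apply: continuous_clamp_comp.
apply: fun_continuousD; last exact: cst_continuous.
apply: fun_continuousM.
  do 2!(apply: fun_continuousB; last exact: cst_continuous).
  by apply: fun_continuousM; first exact: cst_continuous.
apply: fun_continuousV; first by apply: fun_continuousM; first exact: cst_continuous.
by move=> x; rewrite mulf_neq0 // pnatr_eq0.
Qed.

(** Truncation at 1 makes the product a lower bound for each single distance. *)
Definition gap j t : R :=
  \prod_(l < j) \prod_(m < 3 ^ l) Num.min 1 `|3 ^+ l * t - m%:R - q|.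

Lemma min1_itv (y : R) : 0 <= y -> 0 <= Num.min 1 y <= 1.
Proof. by move=> y0; rewrite le_min ler01 y0 ge_min lexx. Qed.

Lemma prod_itv (I : finType) (P : pred I) (F : I -> R) :
  (forall k, 0 <= F k <= 1) -> 0 <= \prod_(k | P k) F k <= 1.
Proof.
move=> F01; elim/big_rec: _ => [|k y _ /andP[y0 y1]]; first by rewrite ler01 lexx.
by have /andP[f0 f1] := F01 k; rewrite mulr_ge0 //= mulr_ile1.
Qed.

Lemma prod_le_factor (I : finType) (P : pred I) (F : I -> R) i : P i ->
  (forall k, 0 <= F k <= 1) -> \prod_(k | P k) F k <= F i.
Proof.
move=> Pi F01; rewrite (bigD1 i) //=; have /andP[Fi _] := F01 i.
by rewrite ler_piMr //; case/andP: (prod_itv (fun k => P k && (k != i)) F01).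
Qed.

Lemma gap_itv j t : 0 <= gap j t <= 1.
Proof. by apply: prod_itv => l; apply: prod_itv => m; apply: min1_itv. Qed.

Lemma gap_le j l m t : (l < j)%N -> (m < 3 ^ l)%N ->
  gap j t <= `|3 ^+ l * t - m%:R - q|.
Proof.
move=> lj ml.
apply: (le_trans (prod_le_factor (i := Ordinal lj) _ _)) => //.
  by move=> k; apply: prod_itv => i; apply: min1_itv.
apply: (le_trans (prod_le_factor (i := Ordinal ml) _ _)) => //.
  by move=> k; apply: min1_itv.
by rewrite ge_min lexx orbT.
Qed.

Lemma gap_eq0 j t : gap j t = 0 -> exists l m, 3 ^+ l * t = m%:R + q.
Proof.
move/eqP/prodf_eq0 => [l _ /prodf_eq0[m _]]; rewrite /Num.min; case: ifP => _.
  by rewrite oner_eq0.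
by rewrite normr_eq0 => /eqP tE; exists l, m; lra.
Qed.

Lemma continuous_gap j : continuous (gap j).
Proof.
apply: continuous_big; first exact: mul_continuous.
move=> l _; apply: continuous_big; first exact: mul_continuous.
move=> m _; apply: continuous_min1; apply: fun_continuous_norm.
do 2!(apply: fun_continuousB; last exact: cst_continuous).
by apply: fun_continuousM; [exact: cst_continuous | move=> ?; exact: cvg_id].
Qed.

End collapse.

Section window_width.
Variables (R : realType) (q : R) (m n : nat).
Implicit Types (x : 'rV[R]_m) (j : nat).

(* A positive multiple of the n-th smallest gap would do; this version is
   visibly continuous. *)
Definition width j x : R :=
  1 / 24 * \prod_(S : {set 'I_m} | #|S| == n)
    Num.min 1 (n%:R^-1 * \sum_(i in S) gap q j (x 0 i)).

Lemma width_factor_itv (S : {set 'I_m}) j x :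
  0 <= Num.min 1 (n%:R^-1 * \sum_(i in S) gap q j (x 0 i)) <= 1.
Proof.
apply: min1_itv; rewrite mulr_ge0 ?invr_ge0 ?ler0n // sumr_ge0 // => i _.
by case/andP: (gap_itv q j (x 0 i)).
Qed.

Lemma width_le j x : width j x <= 1 / 24.
Proof.
have /andP[p0 p1] := prod_itv (fun S : {set 'I_m} => #|S| == n)
  (fun S => width_factor_itv S j x).
by rewrite /width; lra.
Qed.

Lemma gapS j (t : R) : gap q j.+1 t <= gap q j t.
Proof.
rewrite /gap big_ord_recr /= ler_piMr //.
  by case/andP: (gap_itv q j t).
by have /andP[] := prod_itv xpredT (fun k : 'I_(3 ^ j) =>
  min1_itv (normr_ge0 (3 ^+ j * t - k%:R - q))).
Qed.

Lemma widthS j x : width j.+1 x <= width j x.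
Proof.
apply: ler_wpM2l; first by lra.
apply: ler_prod => S _; have /andP[-> _] /= := width_factor_itv S j.+1 x.
rewrite le_min ge_min lexx /= ge_min; apply/orP; right.
apply: ler_wpM2l; first by rewrite invr_ge0.
by apply: ler_sum => i _; exact: gapS.
Qed.

Lemma width_gt0 j x : (#|[set i | gap q j (x 0%R i) == 0%R]%SET| < n)%N ->
  0 < width j x.
Proof.
move=> few; apply: mulr_gt0; first by rewrite divr_gt0.
apply: prodr_gt0 => S /eqP Sn; rewrite lt_min ltr01 /= mulr_gt0 //.
  by rewrite invr_gt0 ltr0n; exact: leq_ltn_trans few.
have g0 i : 0 <= gap q j (x 0 i) by case/andP: (gap_itv q j (x 0 i)).
rewrite lt_neqAle sumr_ge0 // andbT eq_sym; apply/negP => /eqP S0.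
have : S \subset [set i | gap q j (x 0 i) == 0]%SET.
  apply/fintype.subsetP => i iS; rewrite inE.
  by have /eqP := psumr_eq0P (fun i _ => g0 i) S0 iS.
by move/subset_leq_card; rewrite Sn leqNgt few.
Qed.

(** If n gaps were below the width, so would be their average, yet the width is at most 1/24 of that
    average. *)
Lemma card_near j x : (0 < n)%N ->
  (#|[set i | (gap q j (x 0 i) < width j x)%R]%SET| < n)%N.
Proof.
move=> n0; rewrite ltnNge; apply/negP => /card_geqP[s [us ss sP]].
have g0 i : 0 <= gap q j (x 0 i) by case/andP: (gap_itv q j (x 0 i)).
pose S := [set i in s]%SET.
have Sn : #|S| == n by rewrite cardsE (card_uniqP us) ss.
have SP i : i \in S -> gap q j (x 0 i) < width j x.
  by rewrite inE => /sP; rewrite inE.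
set T := \sum_(i in S) gap q j (x 0 i).
have T0 : 0 <= T by apply: sumr_ge0.
have nR : 0 < n%:R :> R by rewrite ltr0n.
have wT : width j x <= 1 / 24 * (n%:R^-1 * T).
  apply: ler_wpM2l; first by lra.
  apply: le_trans (prod_le_factor (i := S) Sn _) _.
    by move=> S'; exact: width_factor_itv.
  by rewrite ge_min lexx orbT.
have : T <= n%:R * width j x.
  rewrite mulr_natl -(eqP Sn) -sumr_const; apply: ler_sum => i iS.
  exact/ltW/SP.
have : n%:R * width j x <= 1 / 24 * T.
  rewrite -(ler_pM2l nR) in wT; apply: le_trans wT _.
  by rewrite mulrCA mulVKf // lt0r_neq0.
move=> h1 h2; have T00 : T = 0 by lra.
have [i iS] : exists i, i \in S by apply/card_gt0P; rewrite (eqP Sn).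
have := SP _ iS; rewrite ltNge => /negP; apply.
by apply: le_trans wT _; rewrite T00 !mulr0.
Qed.

Lemma continuous_width j : continuous (width j).
Proof.
apply: fun_continuousM; first exact: cst_continuous.
apply: continuous_big; first exact: mul_continuous.
move=> S _; apply: continuous_min1; apply: fun_continuousM.
  exact: cst_continuous.
apply: continuous_big; first exact: add_continuous.
move=> i _ x.
apply: (@continuous_comp _ _ _ (fun x : 'rV[R]_m => x 0 i) (gap q j)).
  exact: coord_continuous.
exact: continuous_gap.
Qed.

End window_width.

(** * Moving one coordinate at a time *)

Section stages.
Variables (R : realType) (q : R) (n : nat).
Hypotheses (q_mid : 3 / 8 <= q <= 5 / 8) (n_gt0 : (0 < n)%N).
Local Notation m := n.*2.+1.
Implicit Types (x : 'rV[R]_m) (j l z : nat).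

Lemma middleNP l (t : R) : 0 <= t -> middle l t = false ->
  exists2 z, (z %% 3 != 1)%N & z%:R <= 3 ^+ l.+1 * t <= z.+1%:R.
Proof.
move=> t0 /negbT/asboolPn tm.
have T0 : 0 <= 3 ^+ l.+1 * t by rewrite mulr_ge0 // ltW // exp3_gt0.
have /andP[w1 w2] := truncn_itv T0; set w := Num.trunc _ in w1 w2.
have [w3|w3] := eqVneq (w %% 3)%N 1%N; last by exists w; rewrite // w1 ltW.
have [k wk] : exists k, w = (k * 3).+1 by exists (w %/ 3)%N; lia.
(* What remains is the left end of a middle third, which also closes the preceding third. *)
rewrite wk in w1 w2; exists (k * 3)%N; first by lia.
have [kt|kt] := ltP (k * 3).+1%:R (3 ^+ l.+1 * t).
  by case: tm; exists k; rewrite kt.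
by rewrite andbT (le_trans _ w1) // ler_nat.
Qed.

(** The index of the width is one more than the stage: a gap at j + 1 no smaller than the width at j
    + 1 then keeps a coordinate out of the windows of both stages j and j + 1. *)
Definition approx j x i : R :=
  if j is j'.+1 then collapse q (width q n j'.+2 x) j' (x 0 i) else 0.

Definition tame x := menger_set R n x /\
  (#|[set i | `[< exists l k : nat, (3 ^+ l * x 0 i = k%:R + q)%R >]]%SET| < n)%N.

Section tame_point.
Variables (x : 'rV[R]_m) (tx : tame x).

Lemma tame_itv i : 0 <= x 0 i <= 1.
Proof. exact: menger_unit tx.1 i. Qed.

Lemma tame_width_gt0 j : 0 < width q n j x.
Proof.
apply: width_gt0; apply: leq_ltn_trans tx.2; apply/subset_leq_card.
apply/fintype.subsetP => i; rewrite !inE => /eqP/gap_eq0 gi.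
exact: gi.
Qed.

Lemma approx_itv j i : 0 <= approx j x i <= 1.
Proof.
case: j => [|j]; first by rewrite /= lexx ler01.
apply: collapse_itv => //; [exact: tame_width_gt0 | exact: width_le | exact: tame_itv].
Qed.

Lemma approx_dist j i : `|approx j x i - x 0 i| <= 3 * 3 ^- j.
Proof.
have xi := tame_itv i; case: j => [|j] /=.
  by rewrite sub0r normrN expr0 invr1 ger0_norm; case/andP: xi => *; lra.
have := collapse_dist q_mid (tame_width_gt0 j.+2) (width_le _ _ _ _) j xi.
by rewrite exprS invfM mulrA divff // mul1r.
Qed.

Lemma approx_keep j l z i : (l < j)%N -> (z %% 3 != 1)%N ->
    z%:R <= 3 ^+ l.+1 * x 0 i <= z.+1%:R ->
  z%:R <= 3 ^+ l.+1 * approx j x i <= z.+1%:R.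
Proof.
case: j => [//|j]; rewrite ltnS => lj z3 zx.
apply: collapse_keep => //;
  [exact: tame_width_gt0 | exact: width_le | exact: tame_itv].
Qed.

Lemma approx_nat j i : width q n j.+1 x <= gap q j.+1 (x 0 i) ->
  (exists z, 3 ^+ j * approx j x i = z%:R) /\
  exists z, 3 ^+ j * approx j.+1 x i = z%:R.
Proof.
move=> xi; split; last first.
  apply: collapse_nat; [exact: tame_width_gt0 | move=> k kj].
  by apply: le_trans (widthS _ _ _ _) _; apply: le_trans xi _; exact: gap_le.
case: j xi => [|j] xi; first by exists 0%N; rewrite mulr0.
have [k kj|z zE] := @collapse_nat _ q (width q n j.+2 x) (tame_width_gt0 j.+2) j (x 0 i).
  by apply: le_trans xi _; apply: gap_le => //; exact: leqnSn.
by exists (3 * z)%N; rewrite natrM -zE exprS -mulrA.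
Qed.

(* While one coordinate moves, every other one rests either at the old or at
   the new stage. At a level below j a coordinate never enters a middle third
   that the original point avoids; at the levels from j on, only the moving
   coordinate and the fewer than n near ones can lie in a middle third. *)
Lemma menger_stage j (s : 'I_m -> R) k : (forall i, 0 <= s i <= 1) ->
    (forall i, i != k -> s i = 0 \/ s i = 1) ->
  menger_set R n
    (\row_i (approx j x i + s i * (approx j.+1 x i - approx j x i))).
Proof.
move=> s01 sk; set y := \row_i _.
have yE i : y 0 i = approx j x i + s i * (approx j.+1 x i - approx j x i).
  by rewrite mxE.
have conv (a b c v w : R) i : a <= c * v <= b -> a <= c * w <= b ->
    a <= c * (v + s i * (w - v)) <= b.
  by move=> /andP[? ?] /andP[? ?]; have /andP[? ?] := s01 i; apply/andP; split; nra.
apply: mengerP => [i|l].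
  rewrite yE -[X in _ <= X <= _]mul1r; apply: conv; rewrite mul1r; exact: approx_itv.
have [lj|jl] := ltnP l j.
  apply: leq_trans (menger_middle l tx.1); apply/subset_leq_card.
  apply/fintype.subsetP => i; rewrite !finset.in_set; apply: contraTT => /negbTE.
  move/middleNP; case=> [|z z3 zx]; first by case/andP: (tame_itv i).
  apply/negbT/(@not_middle _ _ _ z) => //; rewrite yE; apply: conv.
    exact: approx_keep.
  by apply: approx_keep => //; exact: ltnW.
pose near := [set i | (gap q j.+1 (x 0 i) < width q n j.+1 x)%R]%SET.
apply: (@leq_trans #|k |: near|%SET); last first.
  by rewrite (leq_trans (leq_card_setU _ _)) // cards1 add1n; exact: card_near.
apply/subset_leq_card/fintype.subsetP => i.
rewrite in_setU1 !finset.in_set; apply: contraTT.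
rewrite negb_or -leNgt => /andP[ik /approx_nat[[z0 z0E] [z1 z1E]]].
have [z zE] : exists z, 3 ^+ j * y 0 i = z%:R.
  rewrite yE; case: (sk _ ik) => ->.
    by exists z0; rewrite mul0r addr0.
  by exists z1; rewrite mul1r addrC subrK.
apply/negbT/(@not_middle _ _ _ (3 ^ (l - j) * z * 3)%N); first by rewrite modnMl.
have -> : 3 ^+ l.+1 * y 0 i = (3 ^ (l - j) * z * 3)%N%:R.
  rewrite !natrM -exp3_nat -zE -{1}(subnK jl) exprS exprD; ring.
by rewrite lexx ler_nat leqnSn.
Qed.

End tame_point.
End stages.

(** * Scheduling the moves in time *)

Section clock.
Variable R : realType.
Implicit Types (t : R) (N M : nat).

(* The N-th move takes place for t in [1 / N.+2, 1 / N.+1]. *)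
Definition clock N t : R := clamp (N.+2%:R * (1 - N.+1%:R * t)).

Lemma clock_itv N t : 0 <= clock N t <= 1. Proof. exact: clamp_itv. Qed.

Lemma clock_le0 N t : t <= 0 -> clock N t = 1.
Proof.
move=> t0; have N1 : 0 <= N.+1%:R :> R by [].
have N2 : 1 <= N.+2%:R :> R by rewrite (ler_nat R 1).
have Nt : 0 <= N.+1%:R * - t by rewrite mulr_ge0 // oppr_ge0.
by apply: clamp_ge1; rewrite -[leLHS]mulr1; apply: ler_pM => //; lra.
Qed.

Lemma clock_eq0 N t : 1 <= N.+1%:R * t -> clock N t = 0.
Proof.
move=> Nt; apply: clamp_le0; have N2 : 0 <= N.+2%:R :> R by [].
by rewrite mulr_ge0_le0 // subr_le0.
Qed.

Lemma clock_order N M t : (N < M)%N -> 0 <= t -> clock N t < 1 -> clock M t = 0.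
Proof.
move=> NM t0 Nt; apply: clock_eq0; rewrite leNgt; apply/negP => Mt.
have MN : N.+2%:R <= M.+1%:R :> R by rewrite ler_nat.
have N2 : N.+2%:R = N.+1%:R + 1 :> R by rewrite natr1.
have N1 : 0 <= N.+1%:R :> R by [].
have Nt1 : N.+2%:R * t <= 1 by apply: le_trans (ltW Mt); exact: ler_wpM2r.
have : N.+1%:R * (N.+2%:R * t) <= N.+1%:R * 1 by exact: ler_wpM2l.
move=> NNt; move: Nt; rewrite /clock clamp_ge1 ?ltxx // mulrBr.
by move: NNt; rewrite N2; lra.
Qed.

Lemma clock_stage t : 0 < t -> exists N,
  (forall M, (M < N)%N -> clock M t = 1) /\ forall M, (N < M)%N -> clock M t = 0.
Proof.
move=> t0.
have [N Nt Nmin] : exists2 N, clock N t < 1 & forall M, clock M t < 1 -> (N <= M)%N.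
  have ex : exists N, clock N t < 1.
    exists (Num.trunc t^-1); rewrite clock_eq0 ?ltr01 //.
    by rewrite -ler_pdivrMr // div1r ltW // truncnS_gt.
  by exists (ex_minn ex); case: ex_minnP.
exists N; split=> M MN; last by apply: clock_order Nt => //; exact: ltW.
apply/eqP; rewrite eq_le; have /andP[_ ->] := clock_itv M t.
by rewrite leNgt; apply: contraL MN => /Nmin; rewrite -leqNgt.
Qed.

Lemma continuous_clock N : continuous (clock N).
Proof.
apply: continuous_clamp_comp; apply: fun_continuousM; first exact: cst_continuous.
apply: fun_continuousB; first exact: cst_continuous.
by apply: fun_continuousM; [exact: cst_continuous | move=> ?; exact: cvg_id].
Qed.

(* The m coordinates move in turn from one term of a sequence of points to the
   next one. *)
Variables (m : nat).
Definition relay (a : nat -> 'I_m -> R) J t (i : 'I_m) : R :=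
  \sum_(j < J) clock (j * m + i) t * (a j.+1 i - a j i).

Lemma relay_le0 a J t i : a 0%N i = 0 -> t <= 0 -> relay a J t i = a J i.
Proof.
move=> a0 t0; rewrite /relay; under eq_bigr do rewrite clock_le0 // mul1r.
by rewrite -(big_mkord xpredT (fun j => a j.+1 i - a j i)) telescope_sumr // a0 subr0.
Qed.

Lemma relay_ge1 a J t i : 1 <= t -> relay a J t i = 0.
Proof.
move=> t1; rewrite /relay big1 // => j _; rewrite clock_eq0 ?mul0r //.
by rewrite -[leLHS]mulr1; apply: ler_pM => //; rewrite (ler_nat R 1).
Qed.

(** At time t a single move N = j * m + k is in progress. Rounds before j are complete and later
    ones have not begun, so the sum telescopes. *)
Lemma relay_stage t : (0 < m)%N -> 0 < t -> exists j k,
  (forall i : 'I_m, i != k -> clock (j * m + i) t = 0 \/ clock (j * m + i) t = 1) /\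
  forall a J i, a 0%N i = 0 -> relay a J t i =
    if (j < J)%N then a j i + clock (j * m + i) t * (a j.+1 i - a j i) else a J i.
Proof.
move=> m0 /clock_stage[N [before after]].
have Nm : (N %% m < m)%N by rewrite ltn_pmod.
exists (N %/ m)%N, (Ordinal Nm); have NE := divn_eq N m; split=> [i ik|a J i a0].
  have [iN|iN] := ltnP i (N %% m).
    by right; apply: before; rewrite {2}NE ltn_add2l.
  left; apply: after; rewrite {1}NE ltn_add2l ltn_neqAle iN andbT eq_sym.
  exact: ik.
set j := (N %/ m)%N.
have early j' : (j' < j)%N -> clock (j' * m + i) t = 1.
  move=> jj; apply: before; apply: (@leq_trans (j'.+1 * m)).
    by rewrite mulSn addnC ltn_add2r.
  by rewrite (leq_trans _ (leq_trunc_div N m)) // leq_mul2r jj orbT.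
have late j' : (j < j')%N -> clock (j' * m + i) t = 0.
  move=> jj; apply: after; apply: (@leq_trans (j.+1 * m)).
    by rewrite ltn_ceil.
  by apply: leq_trans (leq_addr _ _); rewrite leq_mul2r jj orbT.
elim: J => [|J IH]; first by rewrite /relay big_ord0.
rewrite /relay big_ord_recr /= -/(relay a J t i) IH ltnS.
have [jJ|Jj|<-] := ltngtP j J.
- by rewrite (late J) // mul0r addr0.
- by rewrite (early J) // mul1r addrC subrK.
- by [].
Qed.

End clock.

(** * Contraction of the tame sets *)

Section contraction.
Variables (R : realType) (q : R) (n : nat).
Hypotheses (q_mid : 3 / 8 <= q <= 5 / 8) (n_gt0 : (0 < n)%N).
Local Notation m := n.*2.+1.
Local Notation X := (menger_space R n).
Local Notation path x := (relay (fun j => approx q j x)).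

(** The last clause makes [D] a uniform limit of the partial paths. Its constant arises because all
    stages from J on are within 3 * 3 ^- J of x, hence within twice that of stage J. *)
Lemma deformation : exists D : 'rV[R]_m -> R -> 'rV[R]_m,
  [/\ forall x t, t <= 0 -> D x t = x, forall x t, 1 <= t -> D x t = 0,
    forall x t, tame q x -> menger_set R n (D x t)
  & forall x t J i, tame q x -> `|D x t 0 i - path x J t i| <= 6 * 3 ^- J].
Proof.
have stages (t : R) : exists j, 0 < t -> exists k,
    (forall i : 'I_m, i != k -> clock (j * m + i) t = 0 \/ clock (j * m + i) t = 1) /\
    forall (a : nat -> 'I_m -> R) J i, a 0%N i = 0 -> relay a J t i =
      if (j < J)%N then a j i + clock (j * m + i) t * (a j.+1 i - a j i) else a J i.
  have [t0|t0] := ltP 0 t; last by exists 0%N.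
  by have [j jP] := relay_stage (ltn0Sn n.*2) t0; exists j => _; exact: jP.
have [st stP] := choice stages.
(* For t > 0 no round after [st t] has begun, so this partial sum is already the whole series. *)
exists (fun x t => if t <= 0 then x else \row_i path x (st t).+1 t i).
have pow_le J J' : (J <= J')%N -> 3 * 3 ^- J' <= 3 * 3 ^- J :> R.
  move=> JJ; apply: ler_wpM2l => //; rewrite lef_pV2 ?posrE ?exp3_gt0 //.
  by rewrite !exp3_nat ler_nat leq_exp2l.
split=> [x t ->//|x t t1|x t tx|x t J i tx].
- rewrite leNgt (lt_le_trans ltr01 t1) /=; apply/rowP => i.
  by rewrite !mxE relay_ge1.
- have [t0|t0] := leP t 0; first exact: tx.1.
  have [k [stk stE]] := stP t t0.
  have -> : \row_i path x (st t).+1 t i = \row_i (approx q (st t) x i +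
      clock (st t * m + i) t * (approx q (st t).+1 x i - approx q (st t) x i)).
    by apply/rowP => i; rewrite !mxE stE // ltnSn.
  apply: (@menger_stage _ _ _ q_mid n_gt0 x tx (st t)
    (fun i => clock (st t * m + i) t) k) => i; last exact: stk.
  exact: clock_itv.
- have [t0|t0] := leP t 0.
    rewrite relay_le0 // distrC; apply: le_trans (approx_dist q_mid tx J i) _.
    by rewrite ler_wpM2r ?invr_ge0 ?exprn_ge0 // ler_nat.
  have [k [stk stE]] := stP t t0; rewrite mxE !stE // ltnSn.
  have [_|Jst] := ltnP (st t) J.
    by rewrite subrr normr0 mulr_ge0 // invr_ge0 exprn_ge0.
  have d1 := approx_dist q_mid tx J i.
  have d2 := le_trans (approx_dist q_mid tx (st t) i) (pow_le _ _ Jst).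
  have d3 := le_trans (approx_dist q_mid tx (st t).+1 i) (pow_le _ _ (leqW Jst)).
  have /andP[c0 c1] := clock_itv (st t * m + i) t.
  move: d1 d2 d3 c0 c1; rewrite !ler_norml.
  move: (approx q J x i) (approx q (st t) x i) (approx q (st t).+1 x i) (x 0 i)
    (clock _ t) (3 ^- J) => a b c y s r.
  by move=> /andP[? ?] /andP[? ?] /andP[? ?] ? ?; apply/andP; split; nra.
Qed.

Lemma continuous_geometric_limit (T : topologicalType) (f : T -> R)
    (f_ : nat -> T -> R) (C : R) :
    (forall J, continuous (f_ J)) -> (forall x J, `|f x - f_ J x| <= C * 3 ^- J) ->
  continuous f.
Proof.
move=> f_c ff_ x; apply/cvgrPdist_lt => e e0.
have C0 : 0 <= C.
  by have := le_trans (normr_ge0 _) (ff_ x 0%N); rewrite expr0 invr1 mulr1.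
have [J JP] : exists J, C * 3 ^- J < e / 3.
  have e3 : 0 < e / 3 by rewrite divr_gt0.
  exists (Num.trunc (C / (e / 3))); rewrite ltr_pdivrMr ?exp3_gt0 // mulrC.
  rewrite -ltr_pdivrMr //; apply: lt_le_trans (truncnS_gt _) _.
  by rewrite exp3_nat ler_nat ltn_expl.
have /cvgrPdist_lt/(_ (e / 3)) := f_c J x.
rewrite divr_gt0 // => /(_ isT); apply: filterS => y xy.
have := ff_ x J; have := ff_ y J; move: xy JP.
move: (C * 3 ^- J) => d; rewrite !ltr_norml !ler_norml.
by move=> /andP[? ?] ? /andP[? ?] /andP[? ?]; apply/andP; split; lra.
Qed.

(** The uniform estimate gives continuity at time 0 too, where infinitely many moves accumulate. *)
Theorem tame_contractible (A : set X) :
  (forall a : X, A a -> tame q (set_val a)) -> contractible_in R A.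
Proof.
move=> At; have [D [D0 D1 Dm Dp]] := deformation.
pose v (a : A) : 'rV[R]_m := set_val (set_val a).
have tv a : tame q (v a) by apply: At; exact: set_valP.
pose H (p : A * R) : X := exist _ (D (v p.1) p.2) (mem_set (Dm _ p.2 (tv p.1))).
have vc : continuous v.
  move=> a; apply: (@continuous_comp _ _ _ (set_val : A -> X) (set_val : X -> _));
  exact: initial_continuous.
have vic i : continuous (fun p : A * R => v p.1 0 i).
  move=> p; apply: (@continuous_comp _ _ _ (fun p : A * R => v p.1)
    (fun w : 'rV[R]_m => w 0 i)); last exact: coord_continuous.
  apply: (@continuous_comp _ _ _ (@fst A R) v); last exact: vc.
  exact: cvg_fst.
have wc j : continuous (fun p : A * R => width q n j (v p.1)).
  move=> p; apply: (@continuous_comp _ _ _ (fun p : A * R => v p.1) (width q n j)).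
    by apply: (@continuous_comp _ _ _ (@fst A R) v); [exact: cvg_fst | exact: vc].
  exact: continuous_width.
have ac j i : continuous (fun p : A * R => approx q j (v p.1) i).
  case: j => [|j] /=; first exact: cst_continuous.
  apply: continuous_collapse => //.
  by move=> p; rewrite lt0r_neq0 //; exact: tame_width_gt0.
have pc J i : continuous (fun p : A * R => path (v p.1) J p.2 i).
  apply: continuous_big; first exact: add_continuous.
  move=> j _; apply: fun_continuousM; last by apply: fun_continuousB; exact: ac.
  move=> p; apply: (@continuous_comp _ _ _ (@snd A R)); first exact: cvg_snd.
  exact: continuous_clock.
have Hc : continuous H.
  apply: continuous_comp_initial; apply: continuous_rV => i.
  apply: (@continuous_geometric_limit _ _ (fun J p => path (v p.1) J p.2 i) 6) => //.
  by move=> p J; exact: Dp.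
have inj (a b : X) : set_val a = set_val b -> a = b by exact: val_inj.
have z0 : menger_set R n 0.
  apply: mengerP => [i|l]; first by rewrite mxE lexx ler01.
  rewrite [middle_set _ _](_ : _ = finset.set0) ?cards0 //.
  apply/setP => i; rewrite finset.in_set0 finset.in_set mxE.
  by apply: not_middle01; left.
exists (exist _ 0 (mem_set z0)), H; split.
- exact: continuous_subspaceT.
- by move=> a; apply: inj; rewrite /H /= /set_val /= D0.
- by move=> a; apply: inj; rewrite /H /= /set_val /= D1.
Qed.

End contraction.

(** * The two tame sets *)

Section cover.
Variables (R : realType) (n : nat).
Implicit Types (t : R) (l k : nat).

(** 3 * 1/2 = 1 + 1/2. *)
Lemma half_persists l k t l' : 3 ^+ l * t = k%:R + 1 / 2 -> (l <= l')%N ->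
  exists k' : nat, 3 ^+ l' * t = k'%:R + 1 / 2.
Proof.
move=> lk /subnK <-; elim: (l' - l)%N => [|d [k' IH]]; first by exists k.
by exists (3 * k' + 1)%N; rewrite addSn exprS natrD natrM; lra.
Qed.

(** 9 * 3/8 = 3 + 3/8, so the offset recurs at every second level. *)
Lemma three_eighths_persists l k t d : 3 ^+ l * t = k%:R + 3 / 8 ->
  exists k' : nat, 3 ^+ (d.*2 + l) * t = k'%:R + 3 / 8.
Proof.
move=> lk; elim: d => [|d [k' IH]]; first by exists k.
by exists (9 * k' + 3)%N; rewrite doubleS !addSn !exprS natrD natrM; lra.
Qed.

Lemma middle_frac l k t (r : R) : 3 ^+ l * t = k%:R + r -> 1 / 3 < r < 2 / 3 ->
  middle l t.
Proof.
move=> lk /andP[r1 r2]; apply/asboolP; exists k.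
rewrite exprS -mulrA lk -[(k * 3).+2%:R]natr1 -[(k * 3).+1%:R]natr1 natrM.
by apply/andP; split; lra.
Qed.

(* A coordinate on the 1/2-grid has all its later ternary digits equal to 1,
   one on the 3/8-grid has infinitely many of them: n of the former and one of
   the latter cannot coexist. *)
Lemma tame_cover (x : 'rV[R]_(n.*2.+1)) : (0 < n)%N -> menger_set R n x ->
  tame (1 / 2) x \/ tame (3 / 8) x.
Proof.
move=> n0 xm; rewrite /tame.
set S0 := [set i | `[< exists l k : nat, _ = k%:R + 1 / 2 >]]%SET.
set S1 := [set i | `[< exists l k : nat, _ = k%:R + 3 / 8 >]]%SET.
have [?|nS0] := ltnP #|S0| n; first by left.
have [?|nS1] := ltnP #|S1| n; first by right.
have [i1] : exists i, i \in S1 by apply/card_gt0P; apply: leq_trans nS1.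
rewrite finset.in_set => /asboolP[l1 [k1 lk1]].
have ex (i : 'I_(n.*2.+1)) : exists l, i \in S0 ->
    exists k : nat, 3 ^+ l * x 0 i = k%:R + 1 / 2.
  have [|iS] := boolP (i \in S0); last by exists 0%N.
  by rewrite finset.in_set => /asboolP[l lk]; exists l.
have [f fP] := choice ex.
(* A level past every [f i] with the parity of [l1], so that both kinds of coordinates are in a
   middle third there. *)
pose L := ((\max_i f i).*2 + l1)%N.
have S0L i : i \in S0 -> exists k : nat, 3 ^+ L * x 0 i = k%:R + 1 / 2.
  move=> /fP[k fk]; apply: half_persists fk _.
  apply: leq_trans (leq_bigmax i) _; rewrite /L; move: (\max_i f i)%N => M.
  by rewrite -addnn -addnA leq_addr.
have [k1' Lk1] := three_eighths_persists (\max_i f i) lk1.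
have i1S0 : i1 \notin S0.
  apply/negP => /S0L[k0]; rewrite Lk1 => /(congr1 (fun r => r * 8%:R)) e.
  have : (k1' * 8 + 3)%N%:R = (k0 * 8 + 4)%N%:R :> R.
    by rewrite !natrD !natrM; lra.
  by move/eqP; rewrite eqr_nat; lia.
have := menger_middle L xm; rewrite leqNgt => /negP; case.
apply: (@leq_trans #|i1 |: S0|%SET); first by rewrite cardsU1 i1S0 add1n ltnS.
apply/subset_leq_card/fintype.subsetP => i.
case/setU1P => [->|/S0L[k ik]]; rewrite finset.in_set.
  by apply: middle_frac Lk1 _; apply/andP; split; lra.
by apply: middle_frac ik _; apply/andP; split; lra.
Qed.

End cover.

Theorem mainTheorem5 (R : realType) (n : nat) (n_gt0 : (0 < n)%N) :
  catg R (menger_space R n) = (1%N%:E)%E.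
Proof.
have cover1 : categorical_cover R (menger_space R n) 1.
  pose A (i : 'I_2) : set (menger_space R n) :=
    [set x | tame (if i == ord0 then 1 / 2 else 3 / 8) (set_val x)].
  exists A; split.
    apply/seteqP; split => // x _.
    by case: (tame_cover n_gt0 (set_valP x)) => tx; [exists ord0 | exists ord_max].
  move=> i; apply: (@tame_contractible R (if i == ord0 then 1 / 2 else 3 / 8) n) => //.
  by case: ifP => _; apply/andP; split; lra.
have cover0 : ~ categorical_cover R (menger_space R n) 0.
  move=> [A [AT /(_ ord0)]]; rewrite (_ : A ord0 = [set: menger_space R n]).
    exact: menger_not_contractible.
  apply/seteqP; split => // x _.
  by have : [set: menger_space R n] x by []; rewrite -AT => -[i _]; rewrite [i]ord1.
rewrite /catg; case: pselect => [ex|[]]; last by exists 1%N; exact/asboolP.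
congr (_%:E)%E; case: ex_minnP => k /asboolP kcover kmin.
have : (k <= 1)%N by apply: kmin; exact/asboolP.
by case: k kcover {kmin} => [/cover0|[|k]].
Qed.
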